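(* Let $\alpha\in(0,1/2)$ and $\beta\in(0,1-2\alpha)$. There exists a constant $c>0$ that only depends on $\alpha,\beta$ and $\sigma$ such that if $\varepsilon\le c\,\varepsilon^\star$, where $\varepsilon^\star=\varepsilon^\star(\tau)=\sqrt{(1\vee\log\tau)/n}$, then the worst-case probability of correctly excluding $r\notin\Theta$ across all asymptotically valid confidence sets is at most $1-\beta$: $$\limsup_{n\to\infty}\ \sup_{\widehat\Theta\in\mathcal{A}_\alpha}\ \inf_{P\in\mathcal{P}_{1,r}(\varepsilon;\tau)}P(r\notin\widehat\Theta)\ \le\ 1-\beta\qquad\text{for any } r\in[d].$$
   Context: Setting: $\boldsymbol X_1,\dots,\boldsymbol X_{2n}$ are i.i.d. random vectors from a distribution $P$ on $\mathbb{R}^d$, $d\ge2$, with mean $\boldsymbol\mu=(\mu_1,\dots,\mu_d)^\top$; the dimension $d=d_n$ may vary with $n$. Write $[d]=\{1,\dots,d\}$, $a\vee b=\max(a,b)$ (so $1\vee\log 0=1$), and $\Theta=\Theta(P)=\arg\min_{k\in[d]}\mu_k$ for the set of all minimizing indices. $\mathcal{P}$ is the collection of distributions on $\mathbb{R}^d$ that are sub-Gaussian with fixed variance proxy $\sigma^2$: for every unit vector $\boldsymbol v\in\mathbb{R}^d$ and all $\lambda\in\mathbb{R}$, $\mathbb{E}_P[\exp(\lambda\langle\boldsymbol v,\boldsymbol X-\boldsymbol\mu\rangle)]\le\exp(\lambda^2\sigma^2/2)$. A confidence set $\widehat\Theta$ is a subset of $[d]$ computed from $\boldsymbol X_1,\dots,\boldsymbol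 X_{2n}$. The collection of all asymptotic $1-\alpha$ confidence sets for $\Theta$ is $$\mathcal{A}_\alpha=\Bigl\{\widehat\Theta:\ \liminf_{n\to\infty}\inf_{P\in\mathcal{P}}\inf_{k\in\Theta(P)}P(k\in\widehat\Theta)\ge1-\alpha\Bigr\}.$$ For $r\in[d]$, let $\mu_\star=\min_{k\in[d]}\mu_k$ and $\Theta_{-r}=\arg\min_{k\in[d]\setminus\{r\}}\mu_k$ (the set of all minimizers). With $C_n$ any positive sequence such that $C_n\to\infty$, the confusion set is $$\mathbb{C}_r=\Bigl\{k\in[d]\setminus(\{r\}\cup\Theta_{-r}):\ \tfrac{\mu_r-\mu_\star}{2}\le\mu_k-\mu_\star\le C_n\sqrt{\tfrac{\log d}{n}}\Bigr\}.$$ For $\varepsilon>0$ and $\tau\in\{0,1,\dots,d-2\}$, $$\mathcal{P}_{1,r}(\varepsilon;\tau)=\{P\in\mathcal{P}:\ \mu_r-\mu_\star\ge\varepsilon\ \text{and}\ |\mathbb{C}_r|=\tau\}.$$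
   Formalization: The bound is proved for each asymptotically valid sequence of confidence sets (sup over the sets outside the limsup); with the sup inside, it fails: a sequence may be empty at one n and [d] otherwise. The variance proxy is taken with σ>0. *)

(* Defs.v *)
From HB Require Import structures.
From mathcomp Require Import all_boot all_order all_algebra.
From mathcomp Require Import all_classical all_reals all_analysis.

Set Implicit Arguments.
Unset Strict Implicit.
Unset Printing Implicit Defensive.

Import Order.TTheory GRing.Theory Num.Theory.
Import numFieldNormedType.Exports.

Local Open Scope classical_set_scope.
Local Open Scope ring_scope.

Section iid_sample.
Context (disp : measure_display) (T : measurableType disp) (R : realType).

Definition cons_pair (n : nat) (x : T * n.-tuple T) : n.+1.-tuple T :=
  [the n.+1.-tuple T of x.1 :: x.2].

Lemma measurable_cons_pair (n : nat) :
  measurable_fun [set: T * n.-tuple T] (@cons_pair n).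
Proof. by apply: measurable_cons. Qed.

HB.instance Definition _ (n : nat) :=
  isMeasurableFun.Build _ _ _ _ (@cons_pair n) (@measurable_cons_pair n).

(* The m-fold product measure: the joint law of m i.i.d. draws from P. *)
Fixpoint iid_law (P : probability T R) (m : nat) : probability (m.-tuple T) R :=
  match m with
  | 0%N => dirac [tuple]
  | m'.+1 => distribution (product_measure1 P (iid_law P m')) (@cons_pair m')
  end.

End iid_sample.

(* Points of R^d are d.-tuple R, whose sigma-algebra is the one generated by
   the coordinates, i.e., the Borel sigma-algebra of R^d. *)
Section selection_of_minima.
Context (R : realType) (d : nat).
Implicit Types (P : probability (d.-tuple R) R) (r k : 'I_d) (sigma : R).

Definition mean P k : R := fine ('E_P[fun x : d.-tuple R => tnth x k])%E.

Definition centered_proj P (v x : d.-tuple R) : R :=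
  \sum_(k < d) tnth v k * (tnth x k - mean P k).

(* Integrability of the coordinates makes [mean P] the genuine mean vector. *)
Definition sub_gaussian sigma : set (probability (d.-tuple R) R) :=
  [set P : probability (d.-tuple R) R |
    (forall k, P.-integrable [set: d.-tuple R]
                 (fun x : d.-tuple R => (tnth x k)%:E)) /\
    (forall v : d.-tuple R, \sum_(k < d) tnth v k ^+ 2 = 1 ->
     forall lambda : R,
       ('M_P (centered_proj P v) lambda
          <= (expR (lambda ^+ 2 * sigma ^+ 2 / 2))%:E)%E)].

Definition Theta P : {set 'I_d} :=
  [set k : 'I_d | [forall j : 'I_d, mean P k <= mean P j]]%SET.

Definition Theta_minus r P : {set 'I_d} :=
  [set k : 'I_d |
    (k != r) && [forall j : 'I_d, (j != r) ==> (mean P k <= mean P j)]]%SET.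

(* [mean P r] is one of the values being minimised, so this is the minimum of
   all the coordinates of the mean, independently of r. *)
Definition min_mean r P : R := \big[Num.min/mean P r]_(k < d) mean P k.

Definition confusion_set (Cn : R) (n : nat) r P : {set 'I_d} :=
  [set k in ~: (r |: Theta_minus r P) |
    (mean P r - min_mean r P) / 2 <= mean P k - min_mean r P
      <= Cn * Num.sqrt (ln d%:R / n%:R)]%SET.

Definition alternatives sigma (Cn : R) (n : nat) r (eps : R) (tau : nat) :
    set (probability (d.-tuple R) R) :=
  [set P : probability (d.-tuple R) R |
           [/\ sub_gaussian sigma P, eps <= mean P r - min_mean r P
             & #|confusion_set Cn n r P| = tau]].

End selection_of_minima.

(* A confidence set is a whole sequence, in the sample-size parameter n, of
   set-valued statistics of 2n observations in dimension d n. *)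
Definition confidence_procedure (R : realType) (d : nat -> nat) : Type :=
  forall n : nat, (2 * n).-tuple ((d n).-tuple R) -> {set 'I_(d n)}.

Definition asymptotic_confidence_sets (R : realType) (d : nat -> nat)
    (sigma alpha : R) : set (confidence_procedure R d) :=
  [set Th : confidence_procedure R d |
    (forall (n : nat) (k : 'I_(d n)),
       measurable [set x : (2 * n).-tuple ((d n).-tuple R) | k \in Th n x]) /\
    ((1 - alpha)%:E <=
       limn_einf (fun n : nat =>
         ereal_inf [set ereal_inf
             [set iid_law P (2 * n) [set x | k \in Th n x]
               | k in [set k | k \in Theta P]]
           | P in @sub_gaussian R (d n) sigma]))%E].

Arguments asymptotic_confidence_sets {R} d sigma alpha _.

(* For tau = 0 the library convention [ln 0 = 0] gives the intended
   value 1 for the maximum. *)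
Definition eps_star (R : realType) (n tau : nat) : R :=
  Num.sqrt (Num.max 1 (ln tau%:R) / n%:R).

(* Main.v *)
Require Import Defs.
From HB Require Import structures.
From mathcomp Require Import all_boot all_order all_algebra.
From mathcomp Require Import all_classical all_reals all_analysis.
From mathcomp Require Import measurable_realfun ring lra.

Import Order.TTheory GRing.Theory Num.Theory.
Import numFieldNormedType.Exports.

Local Open Scope classical_set_scope.
Local Open Scope ring_scope.

(** The second-moment form of Le Cam's method. Let S be a set of tau + 1
  coordinates other than r. Under the null law the coordinates are independent
  Gaussians of variance sigma^2, with mean 0 on r and S, and a large mean
  elsewhere, so that r is a minimiser and a valid confidence set excludes it
  with probability at most alpha + o(1). Lowering the mean of one j in S by eps
  produces an alternative whose confusion set is S minus j. The likelihood
  ratios of the tau + 1 alternatives over 2n observations are pairwise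
  uncorrelated under the null, hence the chi-square divergence of their uniform
  mixture from the null is (exp (2 n eps^2 / sigma^2) - 1) / (tau + 1). It is
  uniformly small in tau and n as soon as eps is a small multiple of eps_star,
  and then some alternative excludes r with probability at most 1 - beta. *)

(** * Integration against i.i.d. laws *)

Section iid_integral.
Context (disp : measure_display) (T : measurableType disp) (R : realType).
Local Open Scope ereal_scope.

(** Nonnegativity lets Tonelli's theorem peel off the first draw; every later fact on [iid_law] is
    an induction on this step. *)
Lemma ge0_integral_iidS (P : probability T R) (m : nat)
    (f : m.+1.-tuple T -> \bar R) :
  measurable_fun setT f -> (forall x, 0 <= f x) ->
  \int[iid_law P m.+1]_x f x =
  \int[P]_x \int[iid_law P m]_y f (cons_pair (x, y)).
Proof.
move=> mf f0; rewrite /= ge0_integral_distribution//.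
have mfc : measurable_fun setT (f \o @cons_pair _ T m).
  by apply: measurableT_comp => //; exact: measurable_cons_pair.
by rewrite fubini_tonelli1// => x; exact: f0.
Qed.

Lemma ge0_integral_iid0 (P : probability T R) (f : 0.-tuple T -> \bar R) :
  measurable_fun setT f -> (forall x, 0 <= f x) ->
  \int[iid_law P 0]_x f x = f [tuple].
Proof. by move=> mf f0; rewrite /= integral_dirac// diracT mul1e. Qed.

Lemma tnth_cons_pair0 (m : nat) (x : T) (y : m.-tuple T) :
  tnth (cons_pair (x, y)) ord0 = x.
Proof. by rewrite /cons_pair tnth0. Qed.

Lemma tnth_cons_pairS (m : nat) (x : T) (y : m.-tuple T) (i : 'I_m) :
  tnth (cons_pair (x, y)) (lift ord0 i) = tnth y i.
Proof. by rewrite /cons_pair tnthS. Qed.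

Lemma measurable_cons_pairr (m : nat) (x : T) :
  measurable_fun setT (fun y : m.-tuple T => cons_pair (x, y)).
Proof. exact: (@measurable_cons _ _ _ _ (cst x) m id). Qed.

Lemma ge0_integral_iid_tnth (P : probability T R) (m : nat) (k : 'I_m)
    (f : T -> \bar R) :
  measurable_fun [set: T] f -> (forall x, 0 <= f x) ->
  \int[iid_law P m]_x f (tnth x k) = \int[P]_x f x.
Proof.
move=> mf f0; elim: m k => [[]//|m IH] k.
rewrite ge0_integral_iidS//; last first.
  by apply: measurableT_comp => //; exact: measurable_tnth.
have [j ->|->] := unliftP ord0 k.
  under eq_integral do under eq_integral do rewrite tnth_cons_pairS.
  by rewrite IH integral_cst// [X in _ * X]probability_setT mule1.
apply: eq_integral => x _; under eq_integral do rewrite tnth_cons_pair0.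
by rewrite integral_cst// [X in _ * X]probability_setT mule1.
Qed.

(** Independence factors the expectation. It serves twice: over the coordinates of a Gaussian vector
    and over the observations of a sample. *)
Lemma ge0_integral_iid_prod (P : probability T R) (m : nat)
    (f : 'I_m -> T -> R) :
  (forall i, measurable_fun [set: T] (f i)) -> (forall i x, (0 <= f i x)%R) ->
  \int[iid_law P m]_x (\prod_(i < m) f i (tnth x i))%:E =
  \prod_(i < m) \int[P]_x (f i x)%:E.
Proof.
elim: m f => [|m IH] f mf f0.
  rewrite ge0_integral_iid0; first by rewrite !big_ord0.
    by under eq_fun do rewrite big_ord0; exact: measurable_cst.
  by move=> x; rewrite big_ord0.
rewrite ge0_integral_iidS//.
- under eq_integral => x _.
    under eq_integral => y _.
      rewrite big_ord_recl tnth_cons_pair0 EFinM.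
      under eq_bigr do rewrite tnth_cons_pairS.
      over.
    rewrite ge0_integralZl//; last 3 first.
    + apply/measurable_EFinP; apply: measurable_prod => i _.
      by apply: measurableT_comp => //; exact: measurable_tnth.
    + by move=> y _; rewrite lee_fin prodr_ge0.
    + by rewrite lee_fin.
    rewrite (IH (fun i => f (lift ord0 i)))//.
    over.
  rewrite ge0_integralZr//; last 3 first.
  + exact/measurable_EFinP.
  + by move=> x _; rewrite lee_fin.
  + by apply: prode_ge0 => i _; apply: integral_ge0 => x _; rewrite lee_fin.
  by rewrite big_ord_recl.
- apply/measurable_EFinP; apply: measurable_prod => i _.
  by apply: measurableT_comp => //; exact: measurable_tnth.
- by move=> x; rewrite lee_fin prodr_ge0.
Qed.

Lemma ge0_integral_iid_distribution (P : probability T R) (X : {mfun T >-> T})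
    (m : nat) (g : m.-tuple T -> \bar R) :
  measurable_fun setT g -> (forall x, 0 <= g x) ->
  \int[iid_law (distribution P X) m]_x g x =
  \int[iid_law P m]_x g (map_tuple X x).
Proof.
elim: m g => [|m IH] g mg g0.
  rewrite !ge0_integral_iid0//; last first.
    apply: measurableT_comp => //; apply/measurable_fun_tnthP => -[]//.
  by congr g; apply: val_inj.
rewrite !ge0_integral_iidS//; last first.
  apply: measurableT_comp => //; apply/measurable_fun_tnthP => i.
  rewrite (_ : _ \o _ = X \o (fun x => tnth x i)); last first.
    by apply/funext => x /=; rewrite tnth_map.
  by apply: measurableT_comp => //; exact: measurable_tnth.
rewrite ge0_integral_distribution; last 2 first.
- apply: (measurable_fun_fubini_tonelli_F (m2 := iid_law (distribution P X) m)
    (fun z => g (cons_pair z))) => //.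
  by apply: measurableT_comp => //; exact: measurable_cons_pair.
- by move=> y; apply: integral_ge0.
apply: eq_integral => x _; rewrite /comp IH//; last first.
  by apply: measurableT_comp => //; exact: measurable_cons_pairr.
by apply: eq_integral => y _; congr g; apply: val_inj.
Qed.

(** The induction changes variables in the tail first, with the head frozen, and then in the head.
    The maps depend on [i] since a mean shift differs from coordinate to coordinate. *)
Lemma ge0_integral_iid_transport (P : probability T R) (m : nat)
    (phi : 'I_m -> T -> T) (l : 'I_m -> T -> R) :
  (forall i, measurable_fun [set: T] (phi i)) ->
  (forall i, measurable_fun [set: T] (l i)) -> (forall i x, (0 <= l i x)%R) ->
  (forall i (g : T -> \bar R), measurable_fun [set: T] g ->
    (forall x, 0 <= g x) ->
    \int[P]_x g (phi i x) = \int[P]_x (g x * (l i x)%:E)) ->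
  forall g : m.-tuple T -> \bar R,
  measurable_fun setT g -> (forall x, 0 <= g x) ->
  \int[iid_law P m]_x g [tuple phi i (tnth x i) | i < m] =
  \int[iid_law P m]_x (g x * (\prod_(i < m) l i (tnth x i))%:E).
Proof.
elim: m phi l => [|m IH] phi l mphi ml l0 H g mg g0.
  rewrite !ge0_integral_iid0//.
  - by rewrite big_ord0 mule1; congr g; apply: val_inj; rewrite /= [RHS]/= enum_ord0.
  - apply: emeasurable_funM => //; under eq_fun do rewrite big_ord0.
    exact: measurable_cst.
  - by move=> x; rewrite big_ord0 mule1.
  - by apply: measurableT_comp => //; apply/measurable_fun_tnthP => -[].
have mtr n (ph : 'I_n -> T -> T) : (forall i, measurable_fun [set: T] (ph i)) ->
    measurable_fun setT (fun x : n.-tuple T => [tuple ph i (tnth x i) | i < n]).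
  move=> mph; apply/measurable_fun_tnthP => i.
  rewrite (_ : _ \o _ = ph i \o (fun x => tnth x i)); last first.
    by apply/funext => x /=; rewrite tnth_mktuple.
  by apply: measurableT_comp => //; exact: measurable_tnth.
have mpr n (ll : 'I_n -> T -> R) : (forall i, measurable_fun [set: T] (ll i)) ->
    measurable_fun setT (fun x : n.-tuple T => (\prod_(i < n) ll i (tnth x i))%:E).
  move=> mll; apply/measurable_EFinP; apply: measurable_prod => i _.
  by apply: measurableT_comp => //; exact: measurable_tnth.
rewrite !ge0_integral_iidS//; last 3 first.
- by apply: emeasurable_funM => //; exact: mpr.
- by move=> x; rewrite mule_ge0// lee_fin prodr_ge0.
- by apply: measurableT_comp => //; exact: mtr.
pose G x := \int[iid_law P m]_y
  (g (cons_pair (x, y)) * (\prod_(i < m) l (lift ord0 i) (tnth y i))%:E).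
have mG : measurable_fun setT G.
  apply: (measurable_fun_fubini_tonelli_F (m2 := iid_law P m)
    (fun z => g (cons_pair z) *
       (\prod_(i < m) l (lift ord0 i) (tnth z.2 i))%:E)).
  - apply: emeasurable_funM.
      by apply: measurableT_comp => //; exact: measurable_cons_pair.
    by apply: (measurableT_comp (mpr m (fun i => l (lift ord0 i)) _)).
  - by move=> z; rewrite mule_ge0// lee_fin prodr_ge0.
have G0 x : 0 <= G x.
  by apply: integral_ge0 => y _; rewrite mule_ge0// lee_fin prodr_ge0.
transitivity (\int[P]_x G (phi ord0 x)).
  apply: eq_integral => x _; rewrite /G.
  have /= <- := IH (fun i => phi (lift ord0 i)) (fun i => l (lift ord0 i))
    (fun i => mphi _) (fun i => ml _) (fun i => l0 _) (fun i => H _)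
    (fun y => g (cons_pair (phi ord0 x, y))) _ _; last 2 first.
  - by apply: measurableT_comp => //; exact: measurable_cons_pairr.
  - by move=> y; exact: g0.
  apply: eq_integral => y _; congr g; apply: eq_from_tnth => i.
  rewrite tnth_mktuple; have [j ->|->] := unliftP ord0 i.
    by rewrite !tnth_cons_pairS tnth_mktuple.
  by rewrite !tnth_cons_pair0.
rewrite H//; apply: eq_integral => x _.
rewrite /G -ge0_integralZr//; last 3 first.
- by apply: emeasurable_funM; [apply: measurableT_comp => //;
    exact: measurable_cons_pairr|exact: (mpr m (fun i => l (lift ord0 i)))].
- by move=> y _; rewrite mule_ge0// lee_fin prodr_ge0.
- by rewrite lee_fin.
apply: eq_integral => y _; rewrite -muleA -EFinM; congr (_ * _%:E).
rewrite big_ord_recl tnth_cons_pair0 mulrC; congr (_ * _)%R.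
by apply: eq_bigr => i _; rewrite tnth_cons_pairS.
Qed.

End iid_integral.

(** * Translates of the normal law *)

Section normal_translation.
Context (R : realType).
Local Open Scope ereal_scope.
Local Notation mu := (@lebesgue_measure R).

(** [normal_prob] is absolutely continuous, and its Radon-Nikodym derivative agrees almost
    everywhere with the Gaussian density because both have the same integral over every measurable
    set. *)
Lemma ge0_integral_normal_prob (m s : R) (f : R -> \bar R) :
  measurable_fun setT f -> (forall x, 0 <= f x) ->
  \int[normal_prob m s]_x f x = \int[mu]_x (f x * (normal_pdf m s x)%:E).
Proof.
move=> mf f0; pose nu : {finite_measure set (measurableTypeR R) -> \bar R} :=
  normal_prob m s.
have dom : nu `<< mu by exact: normal_prob_dominates.
have mpdf : measurable_fun setT (fun x => (normal_pdf m s x)%:E).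
  by apply/measurable_EFinP; exact: measurable_normal_pdf.
have irn := Radon_Nikodym_SigmaFinite.f_integrable dom.
rewrite -(Radon_Nikodym_SigmaFinite.change_of_variables dom)//.
apply: ae_eq_integral => //.
- by apply: emeasurable_funM => //; exact: measurable_int irn.
- exact: emeasurable_funM.
- apply: ae_eqe_mul2l; apply: integral_ae_eq => //.
  move=> E _ mE; rewrite -(Radon_Nikodym_SigmaFinite.f_integral dom)//.
Qed.

Definition id_measurableTypeR : measurableTypeR R -> R := idfun.

HB.instance Definition _ := @isMeasurableFun.Build _ _ _ _ id_measurableTypeR
  (@measurable_id _ _ setT).

(* [normal_prob] lives on [measurableTypeR R], whose display is not the one of
   the canonical measurable structure of [R]. *)
Definition normal_law (s : R) : probability R R :=
  distribution (normal_prob 0 s) id_measurableTypeR.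

Lemma ge0_integral_normal_law (s : R) (f : R -> \bar R) :
  measurable_fun setT f -> (forall x, 0 <= f x) ->
  \int[normal_law s]_x f x = \int[mu]_x (f x * (normal_pdf 0 s x)%:E).
Proof.
by move=> mf f0; rewrite ge0_integral_distribution// ge0_integral_normal_prob.
Qed.

Lemma lebesgue_measure_shift (v : R) (A : set R) : measurable A ->
  pushforward mu (fun x : R => (x + v)%R : measurableTypeR R) A = mu A.
Proof.
have mv : measurable_fun setT (fun x : R => (x + v)%R : measurableTypeR R).
  exact: measurable_funD.
move=> mA; apply/esym/lebesgue_measure_unique => //= _ [[a b]] _ <-.
rewrite /pushforward/= (_ : _ @^-1` _ = `]a - v, b - v]%classic)%R.
  rewrite !lebesgue_measure_itv/= !lte_fin ltrD2r.
  by case: ifPn => // _; rewrite -!EFinD; congr EFin; ring.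
by apply/seteqP; split => x /=; rewrite !in_itv/= ltrBlDr lerBrDr.
Qed.

Lemma ge0_integral_shift (v : R) (f : R -> \bar R) :
  measurable_fun setT f -> (forall x, 0 <= f x) ->
  \int[mu]_x f (x + v)%R = \int[mu]_x f x.
Proof.
move=> mf f0.
pose phi (x : measurableTypeR R) : measurableTypeR R := ((x : R) + v)%R.
have mphi : measurable_fun setT phi by exact: measurable_funD.
have -> : \int[mu]_x f (x + v)%R = \int[pushforward mu phi]_x f x.
  by rewrite (ge0_integral_pushforward mphi).
by apply: eq_measure_integral => //= A mA _; exact: lebesgue_measure_shift.
Qed.

Lemma ge0_integral_opp (f : R -> \bar R) :
  measurable_fun setT f -> (forall x, 0 <= f x) ->
  \int[mu]_x f (- x)%R = \int[mu]_x f x.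
Proof.
move=> mf f0.
pose phi (x : measurableTypeR R) : measurableTypeR R := (- (x : R))%R.
have mphi : measurable_fun setT phi by exact: measurableT_comp.
have -> : \int[mu]_x f (- x)%R = \int[pushforward mu phi]_x f x.
  by rewrite (ge0_integral_pushforward mphi).
by apply: eq_measure_integral => //= A mA _; exact: lebesgue_measureN.
Qed.

(** The density of the normal law of mean [v] and variance [s ^+ 2] with respect to the centered
    one. *)
Definition shift_lr (s v x : R) : R := expR (v * x / s ^+ 2 - v ^+ 2 / (s ^+ 2 *+ 2)).

Lemma shift_lr_ge0 (s v x : R) : (0 <= shift_lr s v x)%R.
Proof. exact: expR_ge0. Qed.

Lemma measurable_shift_lr (s v : R) : measurable_fun setT (shift_lr s v).
Proof.
apply: measurableT_comp => //; apply: measurable_funB => //.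
by apply: measurable_funM => //; exact: measurable_funM.
Qed.

Lemma normal_pdf_shift (s v x : R) : s != 0%R ->
  normal_pdf 0 s (x - v) = (shift_lr s v x * normal_pdf 0 s x)%R.
Proof.
move=> s0; rewrite !normal_pdfE//= /normal_fun /shift_lr.
rewrite mulrCA; congr (_ * _)%R; rewrite -expRD; congr expR.
by field; rewrite s0.
Qed.

Lemma ge0_integral_normal_shift (s v : R) (g : R -> \bar R) : s != 0%R ->
  measurable_fun setT g -> (forall x, 0 <= g x) ->
  \int[normal_law s]_x g (x + v)%R =
  \int[normal_law s]_x (g x * (shift_lr s v x)%:E).
Proof.
move=> s0 mg g0.
rewrite !ge0_integral_normal_law//; last 3 first.
- apply: emeasurable_funM => //; apply/measurable_EFinP.
  exact: measurable_shift_lr.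
- by move=> x; rewrite mule_ge0// lee_fin shift_lr_ge0.
- by apply: measurableT_comp => //; exact: measurable_funD.
pose h x := g x * (normal_pdf 0 s (x - v))%:E.
rewrite -[LHS]/(\int[mu]_x (g (x + v)%R * (normal_pdf 0 s x)%:E)).
transitivity (\int[mu]_x h (x + v)%R).
  by apply: eq_integral => x _; rewrite /h addrK.
rewrite ge0_integral_shift.
- by apply: eq_integral => x _; rewrite /h normal_pdf_shift// EFinM muleA.
- apply: emeasurable_funM => //; apply/measurable_EFinP.
  apply: measurableT_comp; first exact: measurable_normal_pdf.
  exact: measurable_funB.
- by move=> x; rewrite mule_ge0// lee_fin normal_pdf_ge0.
Qed.

Lemma ge0_integral_normal_opp (s : R) (g : R -> \bar R) : s != 0%R ->
  measurable_fun setT g -> (forall x, 0 <= g x) ->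
  \int[normal_law s]_x g (- x)%R = \int[normal_law s]_x g x.
Proof.
move=> s0 mg g0; rewrite !ge0_integral_normal_law//; last first.
  exact: measurableT_comp.
rewrite -[RHS]ge0_integral_opp.
- apply: eq_integral => x _; rewrite !normal_pdfE//= /normal_fun !subr0.
  by rewrite sqrrN.
- apply: emeasurable_funM => //; apply/measurable_EFinP.
  exact: measurable_normal_pdf.
- by move=> x; rewrite mule_ge0// lee_fin normal_pdf_ge0.
Qed.

Lemma integral_shift_lr (s v : R) : s != 0%R ->
  \int[normal_law s]_x (shift_lr s v x)%:E = 1.
Proof.
move=> s0; transitivity (\int[normal_law s]_x (cst 1 x * (shift_lr s v x)%:E)).
  by apply: eq_integral => x _; rewrite mul1e.
rewrite -ge0_integral_normal_shift// integral_cst//= mul1e.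
exact: probability_setT.
Qed.

(** The second ratio is absorbed by translating the law by [v]; the first one, once translated, is a
    constant times itself and has integral 1. *)
Lemma integral_shift_lrM (s u v : R) : s != 0%R ->
  \int[normal_law s]_x (shift_lr s u x * shift_lr s v x)%:E =
  (expR (u * v / s ^+ 2))%:E.
Proof.
move=> s0; under eq_integral do rewrite EFinM.
have mlr : measurable_fun setT (fun x => (shift_lr s u x)%:E).
  by apply/measurable_EFinP; exact: measurable_shift_lr.
have lr0 x : 0 <= (shift_lr s u x)%:E by rewrite lee_fin shift_lr_ge0.
rewrite -ge0_integral_normal_shift//.
transitivity (\int[normal_law s]_x
    ((expR (u * v / s ^+ 2))%:E * (shift_lr s u x)%:E)).
  apply: eq_integral => x _; rewrite -EFinM /shift_lr -expRD; congr (expR _)%:E.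
  by field.
rewrite ge0_integralZl_EFin ?expR_ge0//.
by rewrite integral_shift_lr// mule1.
Qed.

(** Completing the square: the exponential is a constant multiple of the likelihood ratio of the
    shift [t * s ^+ 2]. *)
Lemma normal_mgf (s t : R) : s != 0%R ->
  \int[normal_law s]_x (expR (t * x))%:E = (expR (t ^+ 2 * s ^+ 2 / 2))%:E.
Proof.
move=> s0; transitivity (\int[normal_law s]_x
    ((expR (t ^+ 2 * s ^+ 2 / 2))%:E * (shift_lr s (t * s ^+ 2) x)%:E)).
  apply: eq_integral => x _; rewrite -EFinM /shift_lr -expRD; congr (expR _)%:E.
  by field.
rewrite ge0_integralZl_EFin ?expR_ge0//; first by rewrite integral_shift_lr// mule1.
- by move=> x _; rewrite lee_fin shift_lr_ge0.
- by apply/measurable_EFinP; exact: measurable_shift_lr.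
Qed.

Lemma integrable_normal_id (s : R) : s != 0%R ->
  (normal_law s).-integrable setT (fun x : R => x%:E).
Proof.
move=> s0; apply/integrableP; split; first exact/measurable_EFinP.
have mexp t : measurable_fun setT (fun x : R => (expR (t * x))%:E).
  by apply/measurable_EFinP; apply: measurableT_comp => //; exact: measurable_funM.
(* The bound |x| <= exp x + exp (- x) reduces integrability to the moment generating function at 1
   and -1. *)
apply: (@le_lt_trans _ _ (\int[normal_law s]_x
    ((expR (1 * x))%:E + (expR (-1 * x))%:E))).
  apply: ge0_le_integral => //=.
  - by apply/measurableT_comp => //; exact/measurable_EFinP.
  - exact: (emeasurable_funD (mexp 1%R) (mexp (-1)%R)).
  - move=> x _; rewrite -EFinD lee_fin mul1r mulN1r ler_norml.
    have := expR_ge1Dx x; have := expR_ge1Dx (- x).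
    by have := expR_ge0 x; have := expR_ge0 (- x); lra.
rewrite ge0_integralD//; [|exact: mexp..].
by rewrite !normal_mgf// -EFinD ltry.
Qed.

Lemma integral_normal_id (s : R) : s != 0%R -> \int[normal_law s]_x x%:E = 0.
Proof.
move=> s0; have ix := integrable_normal_id s s0.
(* Symmetry of the law exchanges the positive and negative parts, whose finite integrals cancel. *)
rewrite integralE; have -> : \int[normal_law s]_x (fun x => x%:E)^\- x =
    \int[normal_law s]_x (fun x => x%:E)^\+ x.
  rewrite -[RHS]ge0_integral_normal_opp//; first last.
    exact/measurable_funepos/measurable_EFinP.
  by apply: eq_integral => x _; rewrite funenegE funeposE EFinN.
rewrite subee//; exact: integral_fune_fin_num (integrable_funepos _ ix).
Qed.

End normal_translation.

(** * Mixtures of likelihood ratios *)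

Section second_moment.
Context (disp : measure_display) (T : measurableType disp) (R : realType).
Context (mu : probability T R) (I : finType).
Local Open Scope ereal_scope.

(* Integrated with y the likelihood ratio of the mixture and a the indicator of
   an event, this bounds the change of the probability of the event by the
   chi-square divergence, and all the integrands are nonnegative. *)
Lemma mixture_le (eta y a : R) : (0 < eta)%R -> (a == 0)%R || (a == 1)%R ->
  (2 * y + 2 * eta * (a * y) <= y ^+ 2 + 1 + (2 * eta + eta ^+ 2) * a)%R.
Proof.
move=> eta0 /orP[] /eqP ->.
  by have := sqr_ge0 (y - 1); rewrite !expr2; lra.
by have := sqr_ge0 (y - 1 - eta); rewrite !expr2; lra.
Qed.

(** Averaging: if every index in [S] exceeded the bound, so would the uniform mixture. The
    likelihood ratio of the mixture has second moment 1 + (K - 1) / #|S|, and integrating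
    [mixture_le] contradicts this. The free parameter [eta] balances the two error terms. *)
Lemma exists_le_mixture (S : {set I}) (L : I -> T -> R) (K eta : R)
    (A : set T) :
  (forall j, measurable_fun setT (L j)) -> (forall j x, (0 <= L j x)%R) ->
  (forall j, \int[mu]_x (L j x)%:E = 1) ->
  (forall i j, \int[mu]_x (L i x * L j x)%:E = if i == j then K%:E else 1) ->
  measurable A -> (0 < eta)%R -> (0 < #|S|)%N ->
  exists2 j, j \in S & \int[mu]_x (\1_A x * L j x)%:E <=
    mu A + (eta / 2 + (K - 1) / (2 * eta * #|S|%:R))%:E.
Proof.
move=> mL L0 L1 LL mA eta0 S0; apply: contrapT => noj.
pose p := fine (mu A); have pE : mu A = p%:E.
  by rewrite fineK// fin_num_measure.
have p1 : (p <= 1)%R by rewrite -lee_fin -pE; exact: probability_le1.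
have mq j : measurable_fun setT (fun x => \1_A x * L j x)%R.
  by apply: measurable_funM => //; exact: measurable_indic.
have q0 j x : (0 <= \1_A x * L j x)%R by rewrite mulr_ge0.
pose q j := fine (\int[mu]_x (\1_A x * L j x)%:E).
have qE j : \int[mu]_x (\1_A x * L j x)%:E = (q j)%:E.
  rewrite fineK// ge0_fin_numE; last by apply: integral_ge0 => x _; rewrite lee_fin.
  rewrite (@le_lt_trans _ _ (\int[mu]_x (L j x)%:E))//; last by rewrite L1 ltry.
  apply: ge0_le_integral => //.
  - by move=> x _; rewrite lee_fin.
  - exact/measurable_EFinP.
  - exact/measurable_EFinP.
  - by move=> x _; rewrite lee_fin ler_piMl// indicE; case: (_ \in _).
set N : R := #|S|%:R; have N0 : (0 < N)%R by rewrite ltr0n.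
pose b := (p + (eta / 2 + (K - 1) / (2 * eta * N)))%R.
have bq j : j \in S -> (b < q j)%R.
  move=> jS; rewrite ltNge; apply/negP => qb; apply: noj; exists j => //.
  by rewrite qE pE -EFinD lee_fin.
(* [F1] and [F2] are the two sides of [mixture_le] at the averaged likelihood ratio, multiplied by
   [N ^+ 2] to clear denominators. *)
pose F1 x := (\sum_(j <- enum S) (2 * N * L j x + 2 * eta * N * (\1_A x * L j x)))%R.
pose F2 x := ((\sum_(i <- enum S) \sum_(j <- enum S) L i x * L j x) +
  (N ^+ 2 + N ^+ 2 * (2 * eta + eta ^+ 2) * \1_A x))%R.
have F1E : \int[mu]_x (F1 x)%:E =
    (\sum_(j <- enum S) (2 * N + 2 * eta * N * q j))%:E.
  rewrite /F1; under eq_integral do rewrite -sumEFin.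
  rewrite ge0_integral_sum//; last 2 first.
  - move=> j; apply/measurable_EFinP; apply: measurable_funD => //.
      exact: measurable_funM.
    exact: measurable_funM.
  - by move=> j x _; rewrite lee_fin addr_ge0// !mulr_ge0// ?ltW.
  rewrite -sumEFin; apply: eq_bigr => j _.
  under eq_integral do rewrite EFinD (EFinM (2 * N)) (EFinM (2 * eta * N)).
  rewrite ge0_integralD//; last 4 first.
  - by move=> x _; rewrite -EFinM lee_fin !mulr_ge0// ltW.
  - by apply: emeasurable_funM => //; exact/measurable_EFinP.
  - by move=> x _; rewrite -EFinM lee_fin !mulr_ge0// ltW.
  - by apply: emeasurable_funM => //; exact/measurable_EFinP.
  rewrite !ge0_integralZl_EFin//; last 6 first.
  - by move=> x _; rewrite lee_fin.
  - exact/measurable_EFinP.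
  - by rewrite !mulr_ge0// ltW.
  - by move=> x _; rewrite lee_fin.
  - exact/measurable_EFinP.
  - by rewrite !mulr_ge0// ltW.
  by rewrite L1 qE mule1 -EFinM -EFinD.
have F2E : \int[mu]_x (F2 x)%:E =
    (N * (K + (N - 1)) + (N ^+ 2 + N ^+ 2 * (2 * eta + eta ^+ 2) * p))%:E.
  rewrite /F2; under eq_integral do rewrite EFinD.
  have mLL i j : measurable_fun setT (fun x => (L i x * L j x)%:E).
    by apply/measurable_EFinP; exact: measurable_funM.
  have c0 : (0 <= N ^+ 2 * (2 * eta + eta ^+ 2))%R.
    by rewrite mulr_ge0 ?sqr_ge0// addr_ge0 ?sqr_ge0// mulr_ge0// ltW.
  rewrite ge0_integralD//; last 4 first.
  - by move=> x _; rewrite lee_fin sumr_ge0// => i _; rewrite sumr_ge0// => j _; rewrite mulr_ge0.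
  - apply/measurable_EFinP; apply: measurable_sum => i.
    by apply: measurable_sum => j; exact: measurable_funM.
  - by move=> x _; rewrite lee_fin addr_ge0 ?sqr_ge0// mulr_ge0.
  - apply/measurable_EFinP; apply: measurable_funD => //.
    by apply: measurable_funM => //; exact: measurable_indic.
  rewrite EFinD; congr (_ + _).
    under eq_integral do rewrite -sumEFin.
    rewrite ge0_integral_sum//; last 2 first.
    - by move=> i; apply/measurable_EFinP; apply: measurable_sum => j; exact: measurable_funM.
    - by move=> i x _; rewrite lee_fin sumr_ge0// => j _; rewrite mulr_ge0.
    (* Each row of the double sum has one diagonal term [K] and [N - 1] off-diagonal terms equal to
       1. *)
    transitivity (\sum_(i <- enum S) (K + (N - 1))%:E); last first.
      by rewrite sumEFin big_enum/= sumr_const -mulr_natl.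
    apply: eq_big_seq => i; rewrite mem_enum => iS.
    under eq_integral do rewrite -sumEFin.
    rewrite ge0_integral_sum//; last first.
      by move=> j x _; rewrite lee_fin mulr_ge0.
    under eq_bigr do rewrite LL.
    rewrite big_enum/= (bigD1 i)//= eqxx.
    rewrite (eq_bigr (fun=> 1)); last by move=> j /andP[_ /negbTE]; rewrite eq_sym => ->.
    rewrite -[X in _ + X]/(\sum_(j in S | j != i) (1%R : R)%:E) sumEFin -EFinD.
    congr (_ + _)%:E; rewrite sumr_const /N (cardD1 i S) iS add1n -natr1 addrK.
    by congr (_%:R); apply: eq_card => j; rewrite !inE andbC.
  under eq_integral do rewrite EFinD (EFinM (N ^+ 2 * _)).
  rewrite ge0_integralD//; last 3 first.
  - by move=> x _; rewrite lee_fin sqr_ge0.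
  - by move=> x _; rewrite -EFinM lee_fin mulr_ge0.
  - by apply: emeasurable_funM => //; apply/measurable_EFinP; exact: measurable_indic.
  rewrite integral_cst// [X in _ * X + _]probability_setT mule1.
  rewrite ge0_integralZl_EFin//; last by apply/measurable_EFinP; exact: measurable_indic.
  have -> : \int[mu]_x (\1_A x)%:E = p%:E by rewrite integral_indic// setIT -pE.
  by rewrite -EFinM -EFinD.
have F12 : \int[mu]_x (F1 x)%:E <= \int[mu]_x (F2 x)%:E.
  have mF1 : measurable_fun setT F1.
    apply: measurable_sum => j; apply: measurable_funD; exact: measurable_funM.
  have mF2 : measurable_fun setT F2.
    apply: measurable_funD.
      by apply: measurable_sum => i; apply: measurable_sum => j; exact: measurable_funM.
    apply: measurable_funD => //; apply: measurable_funM => //; exact: measurable_indic.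
  apply: ge0_le_integral => //.
  - move=> x _; rewrite lee_fin sumr_ge0// => j _.
    by rewrite addr_ge0// !mulr_ge0// ltW.
  - exact/measurable_EFinP.
  - exact/measurable_EFinP.
  - move=> x _; rewrite lee_fin /F1 /F2.
    under [X in (_ <= X + _)%R]eq_bigr do rewrite -mulr_sumr.
    rewrite -mulr_suml big_split/= -!mulr_sumr.
    set Y := (\sum_(j <- enum S) L j x)%R.
    have := @mixture_le eta (Y / N) (\1_A x) eta0.
    rewrite indicE; have -> : ((x \in A)%:R == 0 :> R)%R || ((x \in A)%:R == 1 :> R)%R.
      by case: (x \in A); rewrite !eqxx ?orbT.
    move=> /(_ isT); rewrite -(ler_pM2l (exprn_gt0 2 N0)); congr (_ <= _)%R.
      by field; rewrite gt_eqF.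
    by field; rewrite gt_eqF.
(* Strictness survives the summation because [S] is nonempty. *)
have : (\sum_(j <- enum S) (2 * N + 2 * eta * N * b) <
        \sum_(j <- enum S) (2 * N + 2 * eta * N * q j))%R.
  have [j0 j0S] : exists j, j \in S by apply/card_gt0P.
  rewrite !big_enum/=; apply: ltr_sum; first by apply/hasP; exists j0; rewrite ?mem_index_enum.
  by move=> j jS; rewrite ltrD2l ltr_pM2l ?bq// !mulr_gt0.
apply/negP; rewrite -leNgt; move: F12; rewrite F1E F2E lee_fin => /le_trans; apply.
rewrite big_enum/= sumr_const -[leRHS]mulr_natl -/N.
have -> : (N * (2 * N + 2 * eta * N * b) = N * (K + (N - 1)) +
    (N ^+ 2 + N ^+ 2 * (2 * eta) * p) + N ^+ 2 * eta ^+ 2)%R.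
  by rewrite /b; field; rewrite !gt_eqF.
(* This is exactly the gap between the two sides; it is nonnegative because [p] is a probability. *)
have : (0 <= N ^+ 2 * eta ^+ 2 * (1 - p))%R.
  by apply: mulr_ge0; [rewrite mulr_ge0 ?sqr_ge0|rewrite subr_ge0].
lra.
Qed.

End second_moment.

(** * Gaussian vectors *)

Section shifted_gaussian.
Context (R : realType) (d : nat).
Local Open Scope ereal_scope.
Implicit Types (s : R) (u v w : 'I_d -> R).

Definition shift_tuple v (x : d.-tuple R) : d.-tuple R :=
  [tuple (tnth x k + v k)%R | k < d].

Lemma measurable_shift_tuple v : measurable_fun setT (shift_tuple v).
Proof.
apply/measurable_fun_tnthP => k.
rewrite (_ : _ \o _ = (fun x : d.-tuple R => tnth x k + v k)%R); last first.
  by apply/funext => x /=; rewrite tnth_mktuple.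
by apply: measurable_funD => //; exact: measurable_tnth.
Qed.

HB.instance Definition _ v :=
  isMeasurableFun.Build _ _ _ _ (shift_tuple v) (measurable_shift_tuple v).

(** A centered Gaussian vector with independent coordinates is itself an [iid_law], so the same
    integration rules apply inside a vector and across a sample. Nonzero means enter only by
    translation. *)
Definition gauss0 s : probability (d.-tuple R) R :=
  iid_law (normal_law R s) d.

Definition gauss s v : probability (d.-tuple R) R :=
  distribution (gauss0 s) (shift_tuple v).

Lemma integrable_gauss0_tnth s k : s != 0%R ->
  (gauss0 s).-integrable setT (fun x : d.-tuple R => (tnth x k)%:E).
Proof.
move=> s0; apply/integrableP; split.
  by apply/measurable_EFinP; exact: measurable_tnth.
rewrite (ge0_integral_iid_tnth _ _ _ _ _ k (fun y : R => `|y%:E|))//; last first.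
  by apply: measurableT_comp => //; exact/measurable_EFinP.
by have /integrableP[] := integrable_normal_id R s s0.
Qed.

Lemma integral_gauss0_tnth s k : s != 0%R ->
  \int[gauss0 s]_x (tnth x k)%:E = 0.
Proof.
move=> s0; rewrite -[RHS](integral_normal_id R s s0) [LHS]integralE [RHS]integralE.
congr (_ - _).
  rewrite -(ge0_integral_iid_tnth _ _ _ (normal_law R s) d k)//; last first.
    exact/measurable_funepos/measurable_EFinP.
  by apply: eq_integral => x _; rewrite !funeposE.
rewrite -(ge0_integral_iid_tnth _ _ _ (normal_law R s) d k)//; last first.
  exact/measurable_funeneg/measurable_EFinP.
by apply: eq_integral => x _; rewrite !funenegE.
Qed.

Lemma integrable_shift_tnth s v k : s != 0%R ->
  (gauss0 s).-integrable setT (fun x : d.-tuple R => (tnth x k + v k)%:E).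
Proof.
move=> s0; under eq_fun do rewrite EFinD.
apply: integrableD => //; first exact: integrable_gauss0_tnth.
exact: finite_measure_integrable_cst.
Qed.

Lemma integrable_gauss_tnth s v k : s != 0%R ->
  (gauss s v).-integrable setT (fun x : d.-tuple R => (tnth x k)%:E).
Proof.
move=> s0; apply/integrableP; split.
  by apply/measurable_EFinP; exact: measurable_tnth.
rewrite ge0_integral_distribution//; last first.
  apply: measurableT_comp => //.
  by apply/measurable_EFinP; exact: measurable_tnth.
under eq_integral do rewrite /= tnth_mktuple.
by have /integrableP[] := integrable_shift_tnth s v k s0.
Qed.

Lemma mean_gauss s v k : s != 0%R -> mean (gauss s v) k = v k.
Proof.
move=> s0; rewrite /mean unlock integral_distribution; last 2 first.
- by apply/measurable_EFinP; exact: measurable_tnth.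
- rewrite (_ : _ \o _ = fun x : d.-tuple R => (tnth x k + v k)%:E).
    exact: integrable_shift_tnth.
  by apply/funext => x /=; rewrite tnth_mktuple.
under eq_integral do rewrite /= tnth_mktuple EFinD.
rewrite integralD//; last 2 first.
- exact: integrable_gauss0_tnth.
- exact: finite_measure_integrable_cst.
rewrite integral_gauss0_tnth// add0e integral_cst//.
by rewrite [X in _ * X]probability_setT mule1.
Qed.

(** The moment generating function factors over the coordinates, and the unit norm of [w] makes the
    exponents add up to exactly the sub-Gaussian bound. *)
Lemma sub_gaussian_gauss s v : s != 0%R -> sub_gaussian s (gauss s v).
Proof.
move=> s0; split=> [k|w w1 lambda]; first exact: integrable_gauss_tnth.
have mproj : measurable_fun setT (centered_proj (gauss s v) w).
  apply: measurable_sum => k; apply: measurable_funM => //.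
  by apply: measurable_funB => //; exact: measurable_tnth.
rewrite /mmt_gen_fun unlock ge0_integral_distribution//=; last first.
  apply/measurable_EFinP; apply: measurableT_comp => //.
  exact: measurable_funM.
under eq_integral => x _.
  rewrite /= /centered_proj mulr_suml.
  rewrite expR_sum.
  under eq_bigr do rewrite tnth_mktuple mean_gauss// addrK mulrAC.
  over.
rewrite (ge0_integral_iid_prod _ _ _ _ _
  (fun k y => expR (tnth w k * lambda * y)))//; last first.
  by move=> k; apply: measurableT_comp => //; exact: measurable_funM.
under eq_bigr do rewrite normal_mgf//.
rewrite prodEFin -expR_sum lee_fin ler_expR.
under eq_bigr do rewrite exprMn -2!mulrA.
by rewrite -mulr_suml w1 mul1r mulrA.
Qed.

(** * Likelihood ratios of translated vectors and samples *)

Definition shift_tuple_lr s u (x : d.-tuple R) : R :=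
  \prod_(k < d) shift_lr R s (u k) (tnth x k).

Lemma shift_tuple_lr_ge0 s u x : (0 <= shift_tuple_lr s u x)%R.
Proof. by apply: prodr_ge0 => k _; exact: shift_lr_ge0. Qed.

Lemma measurable_shift_tuple_lr s u : measurable_fun setT (shift_tuple_lr s u).
Proof.
apply: measurable_prod => k _; apply: measurableT_comp.
  exact: measurable_shift_lr.
exact: measurable_tnth.
Qed.

Lemma ge0_integral_gauss0_shift s u (g : d.-tuple R -> \bar R) : s != 0%R ->
  measurable_fun setT g -> (forall x, 0 <= g x) ->
  \int[gauss0 s]_x g (shift_tuple u x) =
  \int[gauss0 s]_x (g x * (shift_tuple_lr s u x)%:E).
Proof.
move=> s0 mg g0.
apply: (ge0_integral_iid_transport _ _ _ (normal_law R s) d (fun k y => y + u k)%R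
  (fun k => shift_lr R s (u k))) => //.
- by move=> k; exact: measurable_funD.
- by move=> k; exact: measurable_shift_lr.
- by move=> k x; exact: shift_lr_ge0.
- by move=> k h mh h0; exact: ge0_integral_normal_shift.
Qed.

(** By independence only the inner product of the two shifts matters, so orthogonal shifts have
    uncorrelated likelihood ratios. *)
Lemma integral_shift_tuple_lrM s u w : s != 0%R ->
  \int[gauss0 s]_x (shift_tuple_lr s u x * shift_tuple_lr s w x)%:E =
  (expR (\sum_(k < d) u k * w k / s ^+ 2))%:E.
Proof.
move=> s0; under eq_integral do rewrite -big_split/=.
rewrite (ge0_integral_iid_prod _ _ _ _ _
  (fun k y => shift_lr R s (u k) y * shift_lr R s (w k) y)%R)//.
- under eq_bigr do rewrite integral_shift_lrM//.
  by rewrite prodEFin -expR_sum.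
- by move=> k; apply: measurable_funM; exact: measurable_shift_lr.
- by move=> k x; rewrite mulr_ge0// shift_lr_ge0.
Qed.

Lemma integral_shift_tuple_lr s u : s != 0%R ->
  \int[gauss0 s]_x (shift_tuple_lr s u x)%:E = 1.
Proof.
move=> s0; rewrite (ge0_integral_iid_prod _ _ _ _ _
  (fun k => shift_lr R s (u k))).
- by under eq_bigr do rewrite integral_shift_lr//; rewrite big1.
- by move=> k; exact: measurable_shift_lr.
- by move=> k x; exact: shift_lr_ge0.
Qed.

Definition sample_lr s (m : nat) u (x : m.-tuple (d.-tuple R)) : R :=
  \prod_(i < m) shift_tuple_lr s u (tnth x i).

Lemma sample_lr_ge0 s m u x : (0 <= sample_lr s m u x)%R.
Proof. by apply: prodr_ge0 => k _; exact: shift_tuple_lr_ge0. Qed.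

Lemma measurable_sample_lr s m u : measurable_fun setT (sample_lr s m u).
Proof.
apply: measurable_prod => i _; apply: measurableT_comp.
  exact: measurable_shift_tuple_lr.
exact: measurable_tnth.
Qed.

Lemma integral_sample_lr s m u : s != 0%R ->
  \int[iid_law (gauss0 s) m]_x (sample_lr s m u x)%:E = 1.
Proof.
move=> s0; rewrite (ge0_integral_iid_prod _ _ _ _ _
  (fun=> shift_tuple_lr s u)).
- by under eq_bigr do rewrite integral_shift_tuple_lr//; rewrite big1.
- by move=> k; exact: measurable_shift_tuple_lr.
- by move=> k x; exact: shift_tuple_lr_ge0.
Qed.

Lemma integral_sample_lrM s m u w : s != 0%R ->
  \int[iid_law (gauss0 s) m]_x (sample_lr s m u x * sample_lr s m w x)%:E =
  (expR (m%:R * \sum_(k < d) u k * w k / s ^+ 2))%:E.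
Proof.
move=> s0; under eq_integral do rewrite -big_split/=.
rewrite (ge0_integral_iid_prod _ _ _ _ _
  (fun _ y => shift_tuple_lr s u y * shift_tuple_lr s w y)%R)//.
- under eq_bigr do rewrite integral_shift_tuple_lrM//.
  by rewrite prodEFin prodr_const card_ord expRM_natl.
- by move=> k; apply: measurable_funM; exact: measurable_shift_tuple_lr.
- by move=> k x; rewrite mulr_ge0// shift_tuple_lr_ge0.
Qed.

Definition shift_sample (m : nat) v (x : m.-tuple (d.-tuple R)) :
  m.-tuple (d.-tuple R) := map_tuple (shift_tuple v) x.

Lemma measurable_shift_sample m v : measurable_fun setT (shift_sample m v).
Proof.
apply/measurable_fun_tnthP => i.
rewrite (_ : _ \o _ = shift_tuple v \o (fun x => tnth x i)); last first.
  by apply/funext => x /=; rewrite tnth_map.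
apply: measurableT_comp; first exact: measurable_shift_tuple.
exact: measurable_tnth.
Qed.

Lemma iid_law_gauss s m v (A : set (m.-tuple (d.-tuple R))) : measurable A ->
  iid_law (gauss s v) m A =
  \int[iid_law (gauss0 s) m]_x (\1_A (shift_sample m v x))%:E.
Proof.
move=> mA; rewrite -[A in LHS]setIT -integral_indic//.
by rewrite ge0_integral_iid_distribution// => *; exact/measurable_EFinP/measurable_indic.
Qed.

Lemma iid_law_gauss_preimage s m v (A : set (m.-tuple (d.-tuple R))) :
  measurable A ->
  iid_law (gauss s v) m A = iid_law (gauss0 s) m (shift_sample m v @^-1` A).
Proof.
move=> mA; rewrite iid_law_gauss// -[X in _ = _ X]setIT -integral_indic//.
by rewrite -[X in measurable X]setTI; exact: measurable_shift_sample.
Qed.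

(** The common shift [v] goes into the event and only the difference [u] into the likelihood ratio.
    The null and all alternatives are thus compared under one centered law. *)
Lemma iid_law_gaussD s m v u (A : set (m.-tuple (d.-tuple R))) : s != 0%R ->
  measurable A ->
  iid_law (gauss s (v \+ u)%R) m A = \int[iid_law (gauss0 s) m]_x
    (\1_(shift_sample m v @^-1` A) x * sample_lr s m u x)%:E.
Proof.
move=> s0 mA; rewrite iid_law_gauss//.
have mB : measurable (shift_sample m v @^-1` A).
  by rewrite -[X in measurable X]setTI; exact: measurable_shift_sample.
under [RHS]eq_integral do rewrite EFinM.
have /= <- := ge0_integral_iid_transport _ _ _ (gauss0 s) m
  (fun=> shift_tuple u) (fun=> shift_tuple_lr s u)
  (fun=> measurable_shift_tuple u) (fun=> measurable_shift_tuple_lr s u)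
  (fun=> shift_tuple_lr_ge0 s u)
  (fun _ g mg g0 => ge0_integral_gauss0_shift s u g s0 mg g0)
  (fun x => (\1_(shift_sample m v @^-1` A) x)%:E) _ _; last 2 first.
- exact/measurable_EFinP/measurable_indic.
- by move=> x; rewrite lee_fin.
apply: eq_integral => x _; rewrite !indicE; congr (_%:R)%:E; congr nat_of_bool.
rewrite -[RHS]/(shift_sample m v [tuple shift_tuple u (tnth x i) | i < m] \in A).
rewrite (_ : shift_sample m (v \+ u)%R x =
  shift_sample m v [tuple shift_tuple u (tnth x i) | i < m])//.
apply: eq_from_tnth => i; rewrite !tnth_map tnth_ord_tuple.
by apply: eq_from_tnth => k; rewrite !tnth_mktuple/= addrAC addrA.
Qed.

End shifted_gaussian.

(** * Least favorable alternatives *)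

Lemma exists_subset_card (I : finType) (A : {set I}) (k : nat) :
  (k <= #|A|)%N -> exists2 S : {set I}, (S \subset A) & #|S| = k.
Proof.
move=> kA; exists [set x in take k (enum A)]%SET.
  by apply/fintype.subsetP => x; rewrite inE => /mem_take; rewrite mem_enum.
have u : uniq (take k (enum A)) by rewrite take_uniq// enum_uniq.
by rewrite cardsE (card_uniqP u) size_take -cardE; case: ltngtP kA.
Qed.

Section least_favorable.
Context (R : realType) (d : nat) (r : 'I_d) (S : {set 'I_d}).
Hypothesis rS : r \notin S.
Context (sigma eps B : R).
Hypotheses (sigma0 : sigma != 0) (eps0 : 0 < eps) (epsB : eps <= B).

(* B will be the upper threshold of the confusion set, which the value B + 1
   exceeds. *)
Definition null_mean (k : 'I_d) : R :=
  if (k == r) || (k \in S) then 0 else B + 1.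

Definition mean_drop (j k : 'I_d) : R := if k == j then - eps else 0.

Lemma r_in_Theta_null : r \in Theta (gauss R d sigma null_mean).
Proof.
rewrite inE; apply/forallP => k; rewrite !mean_gauss// /null_mean eqxx/=.
by case: ifP => // _; have := eps0; have := epsB; lra.
Qed.

Let alt j := gauss R d sigma (null_mean \+ mean_drop j).

Lemma min_mean_alt j : j \in S -> min_mean r (alt j) = - eps.
Proof.
move=> jS; apply/eqP; rewrite eq_le; apply/andP; split.
  apply: (le_trans (bigmin_le_cond _ _ (j := j) isT)).
  by rewrite mean_gauss//= /null_mean jS orbT /mean_drop eqxx add0r.
have H k : - eps <= mean (alt j) k.
  rewrite mean_gauss//= /null_mean /mean_drop.
  by have := eps0; have := epsB; do 2 case: ifP; lra.
by apply/le_bigmin.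
Qed.

Lemma Theta_minus_alt j : j \in S -> Theta_minus r (alt j) = [set j]%SET.
Proof.
move=> jS; have jr : j != r by apply: contraNneq rS => <-.
have altj : mean (alt j) j = - eps.
  by rewrite mean_gauss//= /null_mean /mean_drop jS orbT eqxx add0r.
have alt_ge0 k : k != j -> 0 <= mean (alt j) k.
  move=> kj; rewrite mean_gauss//= /null_mean /mean_drop (negbTE kj) addr0.
  by have := eps0; have := epsB; case: ifP; lra.
apply/setP => k; rewrite !inE; apply/andP/eqP => [[kr /forallP/(_ j)]|->].
  rewrite jr/= altj => h; apply/eqP; apply: contraLR h => kj.
  by have := alt_ge0 k kj; have := eps0; rewrite -ltNge; lra.
split=> //; apply/forallP => i; apply/implyP => _; rewrite altj.
have [->|ij] := eqVneq i j; first by rewrite altj.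
by have := alt_ge0 i ij; have := eps0; lra.
Qed.

(** Relative to the minimum [- eps], the members of [S] other than [j] have height [eps], between
    [eps / 2] and [B]. Coordinates outside [S] and [r] have height [B + 1 + eps], which is too high,
    and [j] drops out as the minimiser. *)
Lemma confusion_set_alt (Cn : R) (n : nat) j : j \in S ->
  B = Cn * Num.sqrt (ln d%:R / n%:R) ->
  confusion_set Cn n r (alt j) = S :\ j.
Proof.
move=> jS BE; rewrite /confusion_set Theta_minus_alt// min_mean_alt// -BE.
apply/setP => k; rewrite !inE.
rewrite !mean_gauss//= /null_mean /mean_drop eqxx/= negb_or.
have jr : j != r by apply: contraNneq rS => <-.
have [->|kr] /= := eqVneq k r; first by rewrite (negbTE rS) andbF.
have [->|kj] //= := eqVneq k j.
rewrite (eq_sym r) (negbTE jr); case: ifP => kS; have := eps0; have := epsB.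
  by move=> *; apply/andP; split; lra.
by move=> *; apply/negbTE/nandP; right; rewrite -ltNge; lra.
Qed.

Lemma alternatives_alt (Cn : R) (n : nat) j : j \in S ->
  B = Cn * Num.sqrt (ln d%:R / n%:R) ->
  alternatives sigma Cn n r eps #|S|.-1 (alt j).
Proof.
move=> jS BE; have jr : r == j = false by apply: contraNF rS => /eqP ->.
split; first exact: sub_gaussian_gauss.
  rewrite min_mean_alt// mean_gauss//= /null_mean /mean_drop eqxx/= jr.
  by lra.
by rewrite confusion_set_alt// (cardsD1 j S) jS.
Qed.

(** Drops at different coordinates have disjoint supports, which is what makes the likelihood ratios
    of the alternatives uncorrelated. *)
Lemma dot_mean_drop i j :
  \sum_(k < d) mean_drop i k * mean_drop j k / sigma ^+ 2 =
  if i == j then eps ^+ 2 / sigma ^+ 2 else 0.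
Proof.
rewrite (bigD1 i)//= /mean_drop eqxx big1 ?addr0 => [|k /negbTE ->].
  by case: ifP => _; rewrite ?mulrNN ?mulr0 ?mul0r ?expr2.
by rewrite !mul0r.
Qed.

End least_favorable.

(** The bound at a fixed n, with [A] the event that [r] is excluded: validity is applied to the null
    law, and the second-moment bound transfers it to one of the tau + 1 alternatives. *)
Lemma exists_alternative_le (R : realType) (d n tau : nat) (r : 'I_d)
    (sigma eps eta Cn p : R) (A : set ((2 * n).-tuple (d.-tuple R))) :
  sigma != 0 -> 0 < eps -> 0 < eta -> (2 <= d)%N -> (tau <= d - 2)%N ->
  eps <= Cn * Num.sqrt (ln d%:R / n%:R) -> measurable A ->
  (forall P : probability (d.-tuple R) R, sub_gaussian sigma P ->
     r \in Theta P -> (iid_law P (2 * n) A <= p%:E)%E) ->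
  exists2 P, alternatives sigma Cn n r eps tau P &
    (iid_law P (2 * n) A <= (p + (eta / 2 +
      (expR ((2 * n)%:R * (eps ^+ 2 / sigma ^+ 2)) - 1) /
      (2 * eta * tau.+1%:R)))%:E)%E.
Proof.
move=> sigma0 eps0 eta0 d2 taud epsC mA nullp.
set B := Cn * Num.sqrt _ in epsC.
(* One index more than [tau], because the lowered one leaves the confusion set. The d - 1
   coordinates other than [r] have room for it since tau <= d - 2. *)
have [S Sr cS] : exists2 S : {set 'I_d}, S \subset [set~ r]%SET & #|S| = tau.+1.
  apply: exists_subset_card; rewrite cardsC1 card_ord.
  by case: d d2 taud {r A mA nullp epsC B} => [|[|d']]//= _; rewrite subn2.
have rS : r \notin S by apply/negP => /(fintype.subsetP Sr); rewrite !inE eqxx.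
set v := null_mean R d r S B.
pose A0 := shift_sample R d (2 * n) v @^-1` A.
have mA0 : measurable A0.
  by rewrite -[A0]setTI; exact: measurable_shift_sample.
pose L j := sample_lr R d sigma (2 * n) (mean_drop R d eps j).
have LL i j : (\int[iid_law (gauss0 R d sigma) (2 * n)]_x (L i x * L j x)%:E =
    if i == j then (expR ((2 * n)%:R * (eps ^+ 2 / sigma ^+ 2)))%:E else 1)%E.
  rewrite integral_sample_lrM// dot_mean_drop; case: ifP => // _.
  by rewrite mulr0 expR0.
have [j jS jA] := exists_le_mixture _ _ _ _ _ S L _ eta A0
  (fun j => measurable_sample_lr _ _ _ _ _) (fun j => sample_lr_ge0 _ _ _ _ _)
  (fun j => integral_sample_lr _ _ _ _ _ sigma0) LL mA0 eta0
  ltac:(by rewrite cS).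
exists (gauss R d sigma (v \+ mean_drop R d eps j)).
  have := alternatives_alt R d r S rS sigma eps B sigma0 eps0 epsC Cn n j jS erefl.
  by rewrite cS.
rewrite iid_law_gaussD//; apply: le_trans jA _.
rewrite [leRHS]EFinD cS leeD2r//.
rewrite -iid_law_gauss_preimage//; apply: nullp.
  exact: sub_gaussian_gauss.
exact: r_in_Theta_null eps0 epsC.
Qed.

(** * Calibration of the separation *)

Lemma expRM_le1D (R : realType) (a x : R) : 0 <= a <= 1 ->
  expR (a * x) <= 1 + a * (expR x - 1).
Proof.
move=> /andP[a0 a1].
(* Weighted sum of the tangent-line bounds at [a * x], evaluated at 0 and x. *)
have e0 := expR_gt0 (a * x).
have h0 : expR (a * x) * (1 - a * x) <= 1.
  by rewrite -[leRHS](expRxMexpNx_1 (a * x)) ler_pM2l// expR_ge1Dx.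
have h1 : expR (a * x) * (1 + (1 - a) * x) <= expR x.
  rewrite (_ : expR x = expR (a * x) * expR ((1 - a) * x)).
    by rewrite ler_pM2l// expR_ge1Dx.
  by rewrite -expRD; congr expR; ring.
have k0 : 0 <= (1 - a) * (1 - expR (a * x) * (1 - a * x)).
  by rewrite mulr_ge0// subr_ge0.
have k1 : 0 <= a * (expR x - expR (a * x) * (1 + (1 - a) * x)).
  by rewrite mulr_ge0// subr_ge0.
nra.
Qed.

(** The left side is the larger of e and tau. The factor tau + 1 cancels the size of the mixture in
    the chi-square bound. *)
Lemma expR_max1_ln_le (R : realType) (tau : nat) :
  expR (Num.max 1 (ln tau%:R)) <= expR 1 * tau.+1%:R :> R.
Proof.
have e1 : 1 <= expR 1 :> R by have := @expR_ge1Dx R 1; lra.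
have [_|] := leP (ln tau%:R : R) 1.
  by rewrite ler_peMr ?expR_ge0// ler1n.
case: tau => [|tau]; first by rewrite ln0// ltr10.
rewrite lnK ?posrE// => _.
by rewrite (le_trans (_ : _ <= tau.+2%:R)) ?ler_nat// ler_peMl.
Qed.

(** Follows from exp (- 1 / 2) >= 1 / 2. This crude value suffices to dominate the 1 in [eps_star]
    by a multiple of ln d for every d >= 2. *)
Lemma ln2_ge (R : realType) : 1 / 2 <= ln 2 :> R.
Proof.
rewrite -ler_expR lnK ?posrE//.
have := expRxMexpNx_1 (1 / 2 : R); have := expR_ge1Dx (- (1 / 2) : R).
have := expR_gt0 (1 / 2 : R); nra.
Qed.

Lemma max1_ln_le (R : realType) (d tau : nat) : (2 <= d)%N -> (tau <= d - 2)%N ->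
  Num.max 1 (ln tau%:R) <= 4 * ln d%:R :> R.
Proof.
move=> d2 td.
have l2 : ln 2 <= ln d%:R :> R.
  by rewrite ler_ln ?posrE ?ltr0n ?ler_nat//; exact: leq_trans d2.
have h := ln2_ge R; rewrite ge_max; apply/andP; split; first lra.
case: tau td => [_|tau td]; first by rewrite ln0//; lra.
suff : ln tau.+1%:R <= ln d%:R :> R by lra.
rewrite ler_ln ?posrE ?ltr0n ?ler_nat//; last exact: leq_trans d2.
exact: leq_trans td (leq_subr _ _).
Qed.

(** Compares the separation with the confusion threshold: once C_n is at least 2 c, a separation of
    at most c times [eps_star] stays below the threshold. *)
Lemma eps_star_le (R : realType) (d n tau : nat) : (2 <= d)%N -> (tau <= d - 2)%N ->
  eps_star R n tau <= 2 * Num.sqrt (ln d%:R / n%:R).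
Proof.
move=> d2 td; rewrite /eps_star.
have -> : 2 * Num.sqrt (ln d%:R / n%:R) = Num.sqrt (2 ^+ 2 * (ln d%:R / n%:R)) :> R.
  by rewrite [RHS]sqrtrM ?sqr_ge0// sqrtr_sqr ger0_norm.
rewrite ler_wsqrtr// mulrA ler_wpM2r ?invr_ge0//.
by rewrite (le_trans (max1_ln_le R _ _ d2 td))//; lra.
Qed.

(** * Eventual bounds and upper or lower limits *)

Lemma limn_esup_le (R : realType) (u : nat -> \bar R) (b : \bar R) :
  (\forall n \near \oo, (u n <= b)%E) -> (limn_esup u <= b)%E.
Proof.
move=> ub; apply: (@le_trans _ _ (ereal_sup (u @` [set n | (u n <= b)%E]))).
  by apply: ereal_inf_lbound; exists [set n | (u n <= b)%E].
by apply: ge_ereal_sup => _ [n /= un <-].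
Qed.

(** Negation turns the lower limit into an infimum, over neighbourhoods of infinity, of suprema;
    some neighbourhood already has its supremum below [- a]. *)
Lemma limn_einf_gt (R : realType) (u : nat -> \bar R) (a b : \bar R) :
  (a < b)%E -> (b <= limn_einf u)%E -> \forall n \near \oo, (a < u n)%E.
Proof.
move=> ab; rewrite /limn_einf leeNr => h.
have : (limn_esup (\- u) < - a)%E by rewrite (le_lt_trans h)// lteN2.
move=> /ereal_inf_lt[_ [V nV <-]] supV.
apply: filterS nV => n Vn; rewrite -lteN2; apply: le_lt_trans supV.
by apply: ereal_sup_ubound; exists n.
Qed.

(* The tuning of the constants: with [g = 1 - beta - alpha] the separation
   [sigma * g / (4 * e)] keeps the chi-square term below [g / 4]. *)
Lemma chi_square_le (R : realType) (sigma g eps : R) (n tau : nat) :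
  0 < sigma -> 0 < g -> g <= 1 -> (0 < n)%N -> 0 < eps ->
  eps <= sigma * g / (4 * expR 1) * eps_star R n tau ->
  (expR ((2 * n)%:R * (eps ^+ 2 / sigma ^+ 2)) - 1) / (2 * (g / 2) * tau.+1%:R)
    <= g / 4.
Proof.
move=> sigma0 g0 g1 n0 eps0 epsle.
have e1 : 1 <= expR 1 :> R by have := @expR_ge1Dx R 1; lra.
have e0 : 0 < expR 1 :> R := expR_gt0 _.
set e := expR 1 in e1 e0 epsle *.
set x := Num.max 1 (ln tau%:R) : R.
have x0 : 0 <= x by rewrite le_max ler01.
have n0' : 0 < n%:R :> R by rewrite ltr0n.
have eps2 : eps ^+ 2 <= (sigma * g / (4 * e)) ^+ 2 * (x / n%:R).
  rewrite -[x / n%:R]sqr_sqrtr ?divr_ge0// -exprMn.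
  by rewrite ler_sqr ?nnegrE ?(ltW eps0)// (le_trans (ltW eps0)).
(* Inserting the bound on [eps] into 2 n eps^2 / sigma^2 gives twice the square of g / (4 e) as the
   coefficient of [x]. *)
pose a := g ^+ 2 / (8 * e ^+ 2).
have a01 : 0 <= a <= 1.
  have de : 0 < 8 * e ^+ 2 by rewrite mulr_gt0 ?exprn_gt0.
  apply/andP; split; first by rewrite divr_ge0 ?sqr_ge0// ltW.
  rewrite ler_pdivrMr//.
  have : g ^+ 2 <= 1 by rewrite expr_le1// ltW.
  have : 1 <= e ^+ 2 by rewrite exprn_ege1.
  lra.
have arg : (2 * n)%:R * (eps ^+ 2 / sigma ^+ 2) <= a * x.
  rewrite mulrA ler_pdivrMr ?exprn_gt0// natrM.
  apply: (le_trans (ler_wpM2l _ eps2)); first by rewrite mulr_ge0.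
  by rewrite le_eqVlt; apply/orP; left; apply/eqP; rewrite /a; field; rewrite !gt_eqF.
(* Convexity extracts the small factor [a], and the remaining exponential costs at most e (tau +
   1). *)
have h : expR ((2 * n)%:R * (eps ^+ 2 / sigma ^+ 2)) - 1 <= a * (e * tau.+1%:R).
  rewrite lerBlDl; apply: (@le_trans _ _ (expR (a * x))); first by rewrite ler_expR.
  apply: (le_trans (expRM_le1D R _ _ a01)); rewrite lerD2l.
  have /andP[a0 _] := a01; apply: ler_wpM2l => //.
  have := expR_max1_ln_le R tau; rewrite -/x -/e; lra.
have t0 : 0 < tau.+1%:R :> R by rewrite ltr0n.
rewrite ler_pdivrMr ?mulr_gt0 ?divr_gt0//; apply: (le_trans h).
(* After tau + 1 cancels, what is left is g^2 / (8 e) <= g^2 / 4, true since e >= 1. *)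
rewrite !mulrA ler_pM2r//.
have -> : a * e = g ^+ 2 / 8 / e by rewrite /a; field; rewrite gt_eqF.
rewrite ler_pdivrMr//.
have : g ^+ 2 <= g ^+ 2 * e by rewrite ler_peMr// sqr_ge0.
have : 0 <= g ^+ 2 by exact: sqr_ge0.
rewrite !expr2; lra.
Qed.

(** * From a fixed sample size to the limit *)

(** Membership in [asymptotic_confidence_sets] constrains the tail of a procedure and leaves its
    value at any single n free apart from measurability, so the supremum over procedures stands
    outside the upper limit. All sequences are quantified after [c], which thus depends only on
    [sigma], [alpha] and [beta]. *)
Theorem corollary3p4 (R : realType) (sigma alpha beta : R)
    (sigma_gt0 : 0 < sigma)
    (alpha_gt0 : 0 < alpha) (alpha_lt : alpha < 1 / 2)
    (beta_gt0 : 0 < beta) (beta_lt : beta < 1 - 2 * alpha) :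
  exists2 c : R, 0 < c &
    forall (d : nat -> nat) (C : nat -> R) (tau : nat -> nat) (eps : nat -> R)
           (r : forall n : nat, 'I_(d n)),
      (forall n : nat, (2 <= d n)%N) ->
      (forall n : nat, 0 < C n) -> C n @[n --> \oo] --> +oo ->
      (forall n : nat, (tau n <= d n - 2)%N) ->
      (forall n : nat, 0 < eps n) ->
      (forall n : nat, (0 < n)%N -> eps n <= c * eps_star R n (tau n)) ->
      (ereal_sup
         [set limn_esup (fun n : nat =>
            ereal_inf
              [set iid_law P (2 * n) [set x | r n \notin Th n x]
                | P in alternatives sigma (C n) n (r n) (eps n) (tau n)])
           | Th in asymptotic_confidence_sets d sigma alpha]
       <= (1 - beta)%:E)%E.
Proof.
(* [g] is the slack between [alpha] and [1 - beta], positive since beta < 1 - 2 alpha. Half of it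
   pays for the asymptotic coverage error and a quarter for each of the two terms of the mixture
   bound. *)
pose g := 1 - beta - alpha; pose c := sigma * g / (4 * expR 1).
have g0 : 0 < g by rewrite /g; lra.
have g20 : 0 < g / 2 by rewrite divr_gt0.
have g1 : g <= 1 by rewrite /g; lra.
have e0 : 0 < expR 1 :> R := expR_gt0 _.
have c0 : 0 < c by rewrite /c divr_gt0// mulr_gt0.
exists c => // d C tau eps r d2 C0 Coo taud eps0 epsle.
apply: ge_ereal_sup => _ [Th [mTh cover] <-].
apply: limn_esup_le; near=> n.
have n0 : (0 < n)%N by near: n; exact: nbhs_infty_gt.
(* The 2 comes from [eps_star_le]; this eventually puts [eps n] below the confusion threshold. *)
have Cn : 2 * c <= C n by near: n; move/cvgryPge : Coo; apply.
pose E := [set x : (2 * n).-tuple ((d n).-tuple R) | r n \in Th n x].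
have mE : measurable E by exact: mTh.
have EC : [set x | r n \notin Th n x] = ~` E.
  by apply/seteqP; split => x /= /negP.
have epsC : eps n <= C n * Num.sqrt (ln (d n)%:R / n%:R).
  apply: (le_trans (epsle n n0)).
  apply: (@le_trans _ _ (c * (2 * Num.sqrt (ln (d n)%:R / n%:R)))).
    by rewrite ler_pM2l// eps_star_le.
  by rewrite mulrA (mulrC c) ler_wpM2r// sqrtr_ge0.
(* The coverage infimum runs over all laws and all minimisers, so one large n serves every null law
   with error g / 2. *)
have null (P : probability ((d n).-tuple R) R) : sub_gaussian sigma P ->
    r n \in Theta P -> (iid_law P (2 * n) (~` E) <= (alpha + g / 2)%:E)%E.
  move=> sgP rP; rewrite probability_setC//.
  have lb : ((1 - alpha - g / 2)%:E <= iid_law P (2 * n) E)%E.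
    apply: ltW; apply: (@lt_le_trans _ _ (ereal_inf [set ereal_inf
             [set iid_law P (2 * n) [set x | k \in Th n x]
               | k in [set k | k \in Theta P]]
           | P in @sub_gaussian R (d n) sigma])).
      near: n; apply: limn_einf_gt cover; rewrite lte_fin; lra.
    apply: (@le_trans _ _ (ereal_inf [set iid_law P (2 * n) [set x | k \in Th n x]
               | k in [set k | k \in Theta P]])).
      by apply: ereal_inf_lbound; exists P.
    by apply: ereal_inf_lbound; exists (r n).
  rewrite leeBlDr ?fin_num_measure//.
  apply: (@le_trans _ _ ((alpha + g / 2)%:E + (1 - alpha - g / 2)%:E)%E).
    by rewrite -EFinD lee_fin; lra.
  by rewrite leeD2l.
have [P altP Ple] := exists_alternative_le R (d n) n (tau n) (r n) sigma (eps n)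
  (g / 2) (C n) _ _ (lt0r_neq0 sigma_gt0) (eps0 n) g20 (d2 n)
  (taud n) epsC (measurableC mE) null.
rewrite EC; apply: (@le_trans _ _ (iid_law P (2 * n) (~` E))).
  by apply: ereal_inf_lbound; exists P.
apply: (le_trans Ple); rewrite lee_fin.
(* The total is alpha + g / 2 + g / 4 + g / 4 = 1 - beta. *)
have := chi_square_le R _ _ _ _ _ sigma_gt0 g0 g1 n0 (eps0 n) (epsle n n0).
set q := (expR _ - 1) / _; have : alpha + g = 1 - beta by rewrite /g; ring.
move: (g) (q) => g' q'; lra.
Unshelve. all: by end_near.
Qed.
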